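(* Let $f:\mathbb{R}^{n\times p}\to\mathbb{R}$ satisfy the smoothness assumption of the context with constant $\rho$, and let $\gamma>\rho$ (and $\gamma>0$). Let $\bar X^{(k)}\in\mathcal{S}_{n,p}$ and let $X^{(k+1)}$ be computed from $\bar X^{(k)}$ by the proximal correction step with parameter $\gamma$. Then $X^{(k+1)}\in\mathcal{S}_{n,p}$. In addition, $$f(\bar X^{(k)})-f(X^{(k+1)})\ge\frac{1}{8c_\gamma}\left\|(\bar X^{(k)})^{\top}\nabla f(\bar X^{(k)})-\nabla f(\bar X^{(k)})^{\top}\bar X^{(k)}\right\|_{\mathrm F}^2,$$ where $c_\gamma=M+\gamma>0$ and $M=\max_{X\in\mathcal{S}_{n,p}}\|\nabla f(X)\|_2$.
   Context: Let $1\le p\le n$ be integers and $\mathcal{S}_{n,p}=\{X\in\mathbb{R}^{n\times p}: X^{\top}X=I_p\}$ (the Stiefel manifold). $\|\cdot\|_{\mathrm F}$ is the Frobenius norm, $\|\cdot\|_2$ applied to a matrix is the spectral norm, and $\nabla f(X)\in\mathbb{R}^{n\times p}$ is the Euclidean gradient with respect to the inner product $\langle Y_1,Y_2\rangle=\mathrm{tr}(Y_1^{\top}Y_2)$. Smoothness assumption: $f:\mathbb{R}^{n\times p}\to\mathbb{R}$ is continuously differentiable and twice differentiable, and $\rho:=\sup_{X\in\tilde{\mathcal S}}\|\nabla^2 f(X)\|_2<\infty$, where $\tilde{\mathcal S}=\{Y\in\mathbb{R}^{n\times p}:\|Y\|_{\mathrm F}^2<p+1\}$ and $\|\nabla^2f(X)\|_2$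 is the operator norm of the Hessian as a linear map on $(\mathbb{R}^{n\times p},\|\cdot\|_{\mathrm F})$. Proximal correction step with parameter $\gamma>0$: given $\bar X^{(k)}\in\mathcal{S}_{n,p}$, let $Z^{(k)}=(\bar X^{(k)})^{\top}\nabla f(\bar X^{(k)})-\gamma I_p$. If $Z^{(k)}=0$, set $X^{(k+1)}=\bar X^{(k)}$. Otherwise take a singular value decomposition $Z^{(k)}=U\Sigma V^{\top}$ ($U,V\in\mathbb{R}^{p\times p}$ orthogonal, $\Sigma$ diagonal with nonnegative entries), set $Q^{(k)}=-UV^{\top}$ and $X^{(k+1)}=\bar X^{(k)}Q^{(k)}$. *)

(* Defs.v *)
From HB Require Import structures.
From mathcomp Require Import all_boot all_order all_algebra.
From mathcomp Require Import all_classical all_reals.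
From mathcomp Require Import ereal topology normedtype derive.

Set Implicit Arguments.
Unset Strict Implicit.
Unset Printing Implicit Defensive.

Import Order.TTheory GRing.Theory Num.Theory.
Import numFieldNormedType.Exports.

Local Open Scope classical_set_scope.
Local Open Scope ring_scope.

(* The library norm on ['M[R]_(m, n)] is the entrywise maximum. It induces the
   same topology and the same differentials as the Frobenius norm, but every
   metric quantity below is stated with [frob]. *)
Definition frob (R : realType) (m n : nat) (A : 'M[R]_(m, n)) : R :=
  Num.sqrt (\tr (A^T *m A)).

Definition opnorm (R : realType) (m n m' n' : nat)
    (L : 'M[R]_(m, n) -> 'M[R]_(m', n')) : R :=
  sup [set frob (L H) | H in [set H | frob H <= 1]].

(* On column vectors [frob] is the Euclidean norm. *)
Definition specnorm (R : realType) (m n : nat) (A : 'M[R]_(m, n)) : R :=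
  opnorm (fun v : 'cV[R]_n => A *m v).

(* [stiefel n n] is the orthogonal group. *)
Definition stiefel (R : realType) (n p : nat) : set 'M[R]_(n, p) :=
  [set X | X^T *m X = 1%:M].

(* Coordinate form of the gradient; [gradP] shows that it represents the
   differential for the inner product [\tr (Y1^T *m Y2)]. *)
Definition grad (R : realType) (n p : nat) (f : 'M[R]_(n, p) -> R)
    (X : 'M[R]_(n, p)) : 'M[R]_(n, p) :=
  \matrix_(i, j) 'd f X (delta_mx i j).

(* The Hessian at [X], as a linear endomorphism of the matrix space, is the
   differential of the gradient field at [X]. *)
Definition hess (R : realType) (n p : nat) (f : 'M[R]_(n, p) -> R)
    (X : 'M[R]_(n, p)) : 'M[R]_(n, p) -> 'M[R]_(n, p) :=
  'd (grad f) X.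

Definition stiefel_nbhd (R : realType) (n p : nat) : set 'M[R]_(n, p) :=
  [set Y | frob Y ^+ 2 < p%:R + 1].

Definition hess_bound (R : realType) (n p : nat) (f : 'M[R]_(n, p) -> R) :
    \bar R :=
  ereal_sup [set (opnorm (hess f X))%:E | X in @stiefel_nbhd R n p].

Definition smooth (R : realType) (n p : nat) (f : 'M[R]_(n, p) -> R)
    (rho : R) : Prop :=
  [/\ forall X, differentiable f X,
      continuous (grad f),
      forall X, differentiable (grad f) X
    & hess_bound f = rho%:E].

Definition is_svd (R : realType) (p : nat) (Z U : 'M[R]_p) (s : 'rV[R]_p)
    (V : 'M[R]_p) : Prop :=
  [/\ stiefel U, stiefel V, forall i, 0 <= s 0 i
    & Z = U *m diag_mx s *m V^T].

(* A relation rather than a function, since the singular value decomposition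
   is an arbitrary choice and is not unique. *)
Definition prox_step (R : realType) (n p : nat) (f : 'M[R]_(n, p) -> R)
    (gamma : R) (X X' : 'M[R]_(n, p)) : Prop :=
  let Z := X^T *m grad f X - gamma%:M in
  (Z = 0 -> X' = X) /\
  (Z <> 0 -> exists U s V, is_svd Z U s V /\ X' = X *m - (U *m V^T)).

Definition is_max (R : realType) (A : set R) (M : R) : Prop :=
  A M /\ ubound A M.

Lemma gradP (R : realType) (n p : nat) (f : 'M[R]_(n, p) -> R)
    (X H : 'M[R]_(n, p)) :
  'd f X H = \tr ((grad f X)^T *m H).
Proof.
transitivity (\sum_i \sum_j H i j * 'd f X (delta_mx i j)).
  rewrite {1}[H]matrix_sum_delta linear_sum; apply: eq_bigr => i _.
  by rewrite linear_sum; apply: eq_bigr => j _; rewrite linearZ.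
rewrite exchange_big; apply: eq_bigr => j _; rewrite mxE.
by apply: eq_bigr => i _; rewrite !mxE mulrC.
Qed.

Lemma frob_sqr (R : realType) (m n : nat) (A : 'M[R]_(m, n)) :
  frob A ^+ 2 = \sum_i \sum_j A i j ^+ 2.
Proof.
have E : \tr (A^T *m A) = \sum_i \sum_j A i j ^+ 2.
  rewrite exchange_big; apply: eq_bigr => j _; rewrite mxE.
  by apply: eq_bigr => i _; rewrite mxE expr2.
rewrite /frob E sqr_sqrtr //.
by apply: sumr_ge0 => i _; apply: sumr_ge0 => j _; exact: sqr_ge0.
Qed.

Lemma opnorm_has_sup (R : realType) (m n m' n' : nat)
    (L : {linear 'M[R]_(m, n) -> 'M[R]_(m', n')}) :
  has_sup [set frob (L H) | H in [set H | frob H <= 1]].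
Proof.
split.
  exists (frob (L 0)), 0 => //=.
  by rewrite /frob mulmx0 mxtrace0 sqrtr0 ler01.
pose B k l := \sum_i \sum_j `|L (delta_mx i j) k l|.
exists (Num.sqrt (\sum_k \sum_l B k l ^+ 2)) => _ /= [H H1 <-].
have F0 a b (A : 'M[R]_(a, b)) : 0 <= frob A by exact: sqrtr_ge0.
have He i j : `|H i j| <= 1.
  apply: le_trans H1; rewrite -(@ler_sqr _ `|_|) ?nnegrE // real_normK ?num_real //.
  rewrite frob_sqr (bigD1 i) //= (bigD1 j) //= -addrA lerDl addr_ge0 //.
    by apply: sumr_ge0 => ? _; exact: sqr_ge0.
  by apply: sumr_ge0 => ? _; apply: sumr_ge0 => ? _; exact: sqr_ge0.
rewrite -(ger0_norm (F0 _ _ (L H))) -sqrtr_sqr; apply: ler_wsqrtr.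
rewrite frob_sqr; apply: ler_sum => k _; apply: ler_sum => l _.
have B0 : 0 <= B k l by apply: sumr_ge0 => ? _; apply: sumr_ge0.
rewrite -real_normK ?num_real // ler_sqr ?nnegrE //.
rewrite [H in L H]matrix_sum_delta linear_sum summxE.
apply: le_trans (ler_norm_sum _ _ _) _; apply: ler_sum => i _.
rewrite linear_sum summxE.
apply: le_trans (ler_norm_sum _ _ _) _; apply: ler_sum => j _.
by rewrite linearZ mxE normrM ler_piMl.
Qed.

(* Main.v *)
Require Import Defs.
From mathcomp Require Import all_boot all_order all_algebra.
From mathcomp Require Import all_classical all_reals.
From mathcomp Require Import ereal topology normedtype derive realfun.
From mathcomp Require Import ring lra.

Set Implicit Arguments.
Unset Strict Implicit.
Unset Printing Implicit Defensive.

Import Order.TTheory GRing.Theory Num.Theory.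
Import numFieldNormedType.Exports.

Local Open Scope classical_set_scope.
Local Open Scope ring_scope.

(** Write [G] for the gradient at [X], [Z = X^T G - gamma I = U S V^T] and
    [Q = - U V^T].  The new point [X' = X Q] is a product of matrices with
    orthonormal columns, hence lies on the Stiefel manifold.

    For the decrease, the segment from [X] to [X'] stays in the ball on which
    the Hessian is bounded ([stiefel_segment]), because both ends have squared
    Frobenius norm [p].  Taylor's inequality ([taylor_hess]) then gives
    [f X' <= f X + tr (G^T (X' - X)) + gamma / 2 * |X' - X|^2].  On the manifold
    [|X' - X|^2 = 2 p - 2 tr Q] is affine in [Q], so the right-hand side is
    [f X + tr (Z^T Q) - tr Z], and [Q] is the orthogonal matrix minimizing
    [tr (Z^T Q)], with value [- sum_j s_j].  Thus the decrease is at least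
    [tr Z + sum_j s_j] ([prox_step_decrease]).

    That quantity controls the skew part of [Z], which is also the skew part
    of [X^T G] ([svd_sum_ge]).  With [W = V^T U] it equals
    [sum_j s_j (1 + W_jj)].  In the basis given by [V], [Z - Z^T] is
    [(W + I) S - ((W + I) S)^T], whose squared norm is at most
    [4 |(W + I) S|^2 = 4 sum_j s_j^2 (2 + 2 W_jj)].  One factor [s_j] is
    absorbed by the bound [s_j <= M + gamma], which holds because
    [|Z v| <= |G v| + gamma |v|] ([frob_prox_matrix_le]).

    The maximum [M] exists since the spectral norm of a continuous gradient is
    continuous and the Stiefel manifold is compact ([compact_stiefel]).

    When [Z = 0] the point does not move, and [X^T G] is symmetric, so both
    sides of the inequality vanish. *)

(** * The Frobenius norm and matrices with orthonormal columns *)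

Lemma mxtrace_trmul (R : realType) (m n : nat) (A B : 'M[R]_(m, n)) :
  \tr (A^T *m B) = \sum_i \sum_j A i j * B i j.
Proof.
rewrite exchange_big; apply: eq_bigr => j _; rewrite mxE.
by apply: eq_bigr => i _; rewrite mxE.
Qed.

Lemma mxtrace_trmulC (R : realType) (m n : nat) (A B : 'M[R]_(m, n)) :
  \tr (A^T *m B) = \tr (B^T *m A).
Proof. by rewrite -mxtrace_tr trmx_mul trmxK. Qed.

Lemma frob_ge0 (R : realType) (m n : nat) (A : 'M[R]_(m, n)) : 0 <= frob A.
Proof. exact: sqrtr_ge0. Qed.

Lemma frob_sqr_tr (R : realType) (m n : nat) (A : 'M[R]_(m, n)) :
  frob A ^+ 2 = \tr (A^T *m A).
Proof.
rewrite frob_sqr mxtrace_trmul.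
by apply: eq_bigr => i _; apply: eq_bigr => j _; rewrite expr2.
Qed.

Lemma frob_eq0 (R : realType) (m n : nat) (A : 'M[R]_(m, n)) :
  frob A = 0 -> A = 0.
Proof.
move=> A0; have /eqP := frob_sqr A; rewrite A0 expr0n /= eq_sym psumr_eq0.
  move=> /allP h; apply/matrixP => i j; rewrite mxE.
  have := h i (mem_index_enum i); rewrite /= psumr_eq0; last first.
    by move=> k _; exact: sqr_ge0.
  by move=> /allP /(_ j (mem_index_enum j)); rewrite /= sqrf_eq0 => /eqP.
by move=> i _; apply: sumr_ge0 => j _; exact: sqr_ge0.
Qed.

Lemma frobZ (R : realType) (m n : nat) (a : R) (A : 'M[R]_(m, n)) :
  frob (a *: A) = `|a| * frob A.
Proof.
rewrite /frob [(a *: A)^T]linearZ /= -scalemxAl -scalemxAr scalerA mxtraceZ.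
by rewrite -expr2 sqrtrM ?sqr_ge0 // sqrtr_sqr.
Qed.

Lemma frob0 (R : realType) (m n : nat) : frob (0 : 'M[R]_(m, n)) = 0.
Proof. by rewrite -(scale0r 0) frobZ normr0 mul0r. Qed.

Lemma frobN (R : realType) (m n : nat) (A : 'M[R]_(m, n)) :
  frob (- A) = frob A.
Proof. by rewrite -scaleN1r frobZ normrN1 mul1r. Qed.

Lemma frob_trmx (R : realType) (m n : nat) (A : 'M[R]_(m, n)) :
  frob A^T = frob A.
Proof. by rewrite /frob trmxK mxtrace_mulC. Qed.

Lemma frob_sqrD (R : realType) (m n : nat) (A B : 'M[R]_(m, n)) :
  frob (A + B) ^+ 2 = frob A ^+ 2 + 2 * \tr (A^T *m B) + frob B ^+ 2.
Proof.
rewrite !frob_sqr_tr [(A + B)^T]linearD /= mulmxDl !mulmxDr !mxtraceD.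
by rewrite (mxtrace_trmulC B A); ring.
Qed.

(** Cauchy-Schwarz: expand the square of the norm of
    [frob B *: A - frob A *: B]. *)
Lemma mxtrace_le_frob (R : realType) (m n : nat) (A B : 'M[R]_(m, n)) :
  \tr (A^T *m B) <= frob A * frob B.
Proof.
have [/frob_eq0 ->|A0] := eqVneq (frob A) 0.
  by rewrite trmx0 mul0mx mxtrace0 mulr_ge0 ?frob_ge0.
have [/frob_eq0 ->|B0] := eqVneq (frob B) 0.
  by rewrite mulmx0 mxtrace0 mulr_ge0 ?frob_ge0.
have a0 : 0 < frob A by rewrite lt_def A0 frob_ge0.
have b0 : 0 < frob B by rewrite lt_def B0 frob_ge0.
have := sqr_ge0 (frob (frob B *: A + (- frob A) *: B)).
rewrite frob_sqrD !frobZ normrN !ger0_norm ?frob_ge0 //.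
rewrite [(_ *: A)^T]linearZ /= -scalemxAl -scalemxAr !mxtraceZ => h.
have {}h : 0 <= (2 * (frob A * frob B)) * (frob A * frob B - \tr (A^T *m B)).
  by apply: le_trans h _; rewrite le_eqVlt; apply/orP; left; apply/eqP; ring.
by rewrite pmulr_rge0 ?subr_ge0 // in h; rewrite !mulr_gt0.
Qed.

Lemma frobD_le (R : realType) (m n : nat) (A B : 'M[R]_(m, n)) :
  frob (A + B) <= frob A + frob B.
Proof.
rewrite -ler_sqr ?nnegrE ?addr_ge0 ?frob_ge0 // frob_sqrD sqrrD.
by have := mxtrace_le_frob A B; lra.
Qed.

Lemma frobB_le (R : realType) (m n : nat) (A B : 'M[R]_(m, n)) :
  frob (A - B) <= frob A + frob B.
Proof. by rewrite -(frobN B) frobD_le. Qed.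

(** Each entry of [A v] is the inner product of [v] with a row of [A]. *)
Lemma frob_mulmx_col (R : realType) (m n : nat) (A : 'M[R]_(m, n))
    (v : 'cV[R]_n) : frob (A *m v) <= frob A * frob v.
Proof.
rewrite -ler_sqr ?nnegrE ?mulr_ge0 ?frob_ge0 // exprMn.
rewrite (frob_sqr (A *m v)) (frob_sqr A) big_distrl /=.
apply: ler_sum => i _; rewrite big_ord1.
have -> : \sum_j A i j ^+ 2 = frob (row i A)^T ^+ 2.
  rewrite frob_trmx frob_sqr big_ord1.
  by apply: eq_bigr => j _; rewrite mxE.
have tE (w : 'cV[R]_n) : (A *m w) i 0 = \tr ((row i A)^T^T *m w).
  by rewrite trmxK trace_mx11 -row_mul [RHS]mxE.
have hw (w : 'cV[R]_n) : (A *m w) i 0 <= frob (row i A)^T * frob w.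
  by rewrite tE mxtrace_le_frob.
rewrite -exprMn -real_normK ?num_real // ler_sqr ?nnegrE ?mulr_ge0 ?frob_ge0 //.
(* The lower bound is the upper bound at [- v]. *)
rewrite ler_norml hw andbT lerNl.
by have := hw (- v); rewrite frobN mulmxN mxE.
Qed.

Lemma frob_mul_stiefel (R : realType) (m n q : nat) (U : 'M[R]_(m, n))
    (A : 'M[R]_(n, q)) : stiefel U -> frob (U *m A) = frob A.
Proof.
rewrite /stiefel /= => hU.
by rewrite /frob trmx_mul -mulmxA (mulmxA U^T) hU mul1mx.
Qed.

(** Bessel's inequality: [U U^T A] is the orthogonal projection of [A] on the
    range of [U], so [|A|^2 - |U^T A|^2] is the square of the norm of
    [A - U U^T A]. *)
Lemma frob_tr_stiefel_le (R : realType) (m n q : nat) (U : 'M[R]_(m, n))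
    (A : 'M[R]_(m, q)) : stiefel U -> frob (U^T *m A) <= frob A.
Proof.
move=> hU; rewrite -ler_sqr ?nnegrE ?frob_ge0 //.
have := sqr_ge0 (frob (A + - (U *m (U^T *m A)))).
have tE : \tr (A^T *m - (U *m (U^T *m A))) = - frob (U^T *m A) ^+ 2.
  by rewrite frob_sqr_tr trmx_mul trmxK mulmxN raddfN /= !mulmxA.
by rewrite frob_sqrD frobN frob_mul_stiefel // tE; lra.
Qed.

Lemma stiefel_trmx (R : realType) (p : nat) (U : 'M[R]_p) :
  stiefel U -> stiefel U^T.
Proof. by rewrite /stiefel /= trmxK => /mulmx1C. Qed.

Lemma stiefel_mul (R : realType) (m n q : nat) (U : 'M[R]_(m, n))
    (V : 'M[R]_(n, q)) : stiefel U -> stiefel V -> stiefel (U *m V).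
Proof.
rewrite /stiefel /= => hU hV.
by rewrite trmx_mul -mulmxA (mulmxA U^T) hU mul1mx.
Qed.

Lemma frob_sqr_stiefel (R : realType) (n p : nat) (X : 'M[R]_(n, p)) :
  stiefel X -> frob X ^+ 2 = p%:R.
Proof. by move=> hX; rewrite frob_sqr_tr hX mxtrace1. Qed.

(** * Operator norms *)

Lemma frob_le_opnorm (R : realType) (m n m' n' : nat)
    (L : {linear 'M[R]_(m, n) -> 'M[R]_(m', n')}) (H : 'M[R]_(m, n)) :
  frob (L H) <= opnorm L * frob H.
Proof.
have [/frob_eq0 ->|H0] := eqVneq (frob H) 0.
  by rewrite linear0 !frob0 mulr0.
have h0 : 0 < frob H by rewrite lt_def H0 frob_ge0.
have HE : H = frob H *: ((frob H)^-1 *: H) by rewrite scalerA divff ?scale1r.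
rewrite {1}HE linearZ /= frobZ ger0_norm ?frob_ge0 // mulrC ler_pM2r //.
apply: ub_le_sup; first by have [] := opnorm_has_sup L.
exists ((frob H)^-1 *: H) => //=.
by rewrite frobZ ger0_norm ?invr_ge0 ?frob_ge0 // mulVf.
Qed.

Lemma opnorm_le (R : realType) (m n m' n' : nat)
    (L : {linear 'M[R]_(m, n) -> 'M[R]_(m', n')}) (c : R) :
  (forall H, frob H <= 1 -> frob (L H) <= c) -> opnorm L <= c.
Proof.
move=> hc; apply: ge_sup; first by have [] := opnorm_has_sup L.
by move=> _ [H /= H1 <-]; exact: hc.
Qed.

Lemma opnorm_ge0 (R : realType) (m n m' n' : nat)
    (L : {linear 'M[R]_(m, n) -> 'M[R]_(m', n')}) : 0 <= opnorm L.
Proof.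
apply: ub_le_sup; first by have [] := opnorm_has_sup L.
by exists 0 => /=; rewrite ?linear0 frob0.
Qed.

Lemma frob_le_specnorm (R : realType) (m n : nat) (A : 'M[R]_(m, n))
    (v : 'cV[R]_n) : frob (A *m v) <= specnorm A * frob v.
Proof. exact: (@frob_le_opnorm _ _ _ _ _ (mulmx A) v). Qed.

Lemma specnorm_ge0 (R : realType) (m n : nat) (A : 'M[R]_(m, n)) :
  0 <= specnorm A.
Proof. exact: (@opnorm_ge0 _ _ _ _ _ (mulmx A)). Qed.

(** The spectral norm is subadditive and dominated by the Frobenius norm. *)
Lemma specnorm_lipschitz (R : realType) (m n : nat) (A B : 'M[R]_(m, n)) :
  specnorm A <= specnorm B + frob (A - B).
Proof.
apply: (@opnorm_le _ _ _ _ _ (mulmx A)) => v v1 /=.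
have -> : A *m v = B *m v + (A - B) *m v by rewrite -mulmxDl addrC subrK.
apply: le_trans (frobD_le _ _) _; apply: lerD.
  by apply: le_trans (frob_le_specnorm _ _) _; rewrite ler_piMr ?specnorm_ge0.
by apply: le_trans (frob_mulmx_col _ _) _; rewrite ler_piMr ?frob_ge0.
Qed.

(** * Compactness of the Stiefel manifold *)

Lemma continuous_sumr (R : realType) (T : topologicalType) (n : nat)
    (F : 'I_n -> T -> R) :
  (forall i, continuous (F i)) -> continuous (fun t => \sum_i F i t).
Proof. by move=> cF; apply: continuous_big => //; exact: add_continuous. Qed.

Lemma continuous_mxE (R : realType) (T : topologicalType) (m n : nat)
    (F : T -> 'M[R]_(m, n)) :
  (forall i j, continuous (fun t => F t i j)) -> continuous F.
Proof.
move=> cF t; apply/cvg_ballP => e e0.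
have : \forall s \near t, forall ij : 'I_m * 'I_n,
    ball (F t ij.1 ij.2) e (F s ij.1 ij.2).
  by apply: filter_forall => -[i j] /=; exact: (cvg_ball (cF i j t)).
by apply: filterS => s h; split=> // i j; exact: (h (i, j)).
Qed.

Lemma stiefelP (R : realType) (n p : nat) (X : 'M[R]_(n, p)) :
  stiefel X <-> forall i j, \sum_k X k i * X k j = (i == j)%:R.
Proof.
split=> [/= + i j|h].
  move=> /matrixP /(_ i j); rewrite !mxE => <-.
  by apply: eq_bigr => k _; rewrite mxE.
apply/matrixP => i j; rewrite !mxE -h.
by apply: eq_bigr => k _; rewrite mxE.
Qed.

(** [vec_mx] identifies the manifold with a closed set of row vectors, to which
    the Heine-Borel theorem applies. The set is bounded since the entries of a
    unit column have absolute value at most 1. *)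
Lemma compact_stiefel (R : realType) (n p : nat) : compact (@stiefel R n p).
Proof.
pose A := [set v : 'rV[R]_(n * p) | stiefel (vec_mx v)].
have centry i j : continuous (fun v : 'rV[R]_(n * p) => vec_mx v i j).
  rewrite (_ : (fun _ => _) = fun v : 'rV[R]_(n * p) => v 0 (mxvec_index i j)).
    exact: coord_continuous.
  by apply/funext => v; rewrite -[v in RHS]vec_mxK mxvecE.
have -> : @stiefel R n p = vec_mx @` A.
  apply/seteqP; split=> [X hX|_ [v hv <-] //].
  by exists (mxvec X); rewrite /A /= mxvecK.
apply: continuous_compact.
  by apply: continuous_subspaceT; exact: continuous_mxE.
apply: bounded_closed_compact.
  exists 1; split=> // M M1 v /= /stiefelP hv.
  rewrite [leLHS]/Num.Def.normr /= mx_normrE.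
  apply/bigmax_leP; split=> [|[i k] _ /=].
    by rewrite (le_trans ler01) ?ltW.
  apply: le_trans (ltW M1); rewrite ord1.
  case/mxvec_indexP: k => a b.
  have -> : v 0 (mxvec_index a b) = vec_mx v a b.
    by rewrite -[v in LHS]vec_mxK mxvecE.
  rewrite -(@ler_sqr _ `|_|) ?nnegrE // real_normK ?num_real // expr1n.
  have E := hv b b; rewrite eqxx mulr1n in E; rewrite -[leRHS]E.
  rewrite (bigD1 a) //= -expr2 lerDl.
  by apply: sumr_ge0 => k _; rewrite -expr2 sqr_ge0.
have -> : A = \bigcap_(ij in [set: 'I_p * 'I_p])
    [set v | \sum_k vec_mx v k ij.1 * vec_mx v k ij.2 = (ij.1 == ij.2)%:R].
  apply/seteqP; split=> v /=.
    by move=> /stiefelP hv [i j] _ /=.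
  by move=> hv; apply/stiefelP => i j; exact: (hv (i, j)).
apply: closed_bigI => -[i j] _ /=.
apply: (@closed_comp _ _ (fun v : 'rV[R]_(n * p) =>
  \sum_k vec_mx v k i * vec_mx v k j) [set x | x = (i == j)%:R]).
  move=> v _; apply: continuous_sumr => k {}v.
  by apply: continuousM; exact: centry.
exact: closed_eq.
Qed.

Lemma continuous_frob (R : realType) (m n : nat) :
  continuous (@frob R m n).
Proof.
move=> A.
rewrite (_ : @frob R m n = Num.sqrt \o fun A => \sum_i \sum_j A i j ^+ 2).
  apply: continuous_comp; last exact: sqrt_continuous.
  apply: continuous_sumr => i; apply: continuous_sumr => j B.
  exact: (continuous_comp (@coord_continuous _ _ _ i j B)
    (@exprn_continuous _ 2 _)).
by apply/funext => B /=; rewrite -frob_sqr sqrtr_sqr ger0_norm ?frob_ge0.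
Qed.

(** Stated over an arbitrary topological space, with [d] standing for a
    distance that is not the canonical one: [frob (A - B)] in the use below,
    while the topology of matrices comes from the maximum norm. *)
Lemma continuous_dist_le (R : realType) (T : topologicalType) (h : T -> R)
    (d : T -> T -> R) :
  (forall x y, `|h x - h y| <= d x y) -> (forall x, d x x = 0) ->
  (forall x, continuous (d x)) -> continuous h.
Proof.
move=> hd d0 cd x; apply/cvgrPdist_lt => e e0.
have /cvgrPdist_lt /(_ _ e0) := cd x x; rewrite d0.
apply: filterS => y; rewrite sub0r normrN; apply: le_lt_trans.
exact: le_trans (hd x y) (ler_norm _).
Qed.

Lemma continuous_specnorm (R : realType) (m n : nat) :
  continuous (@specnorm R m n).
Proof.
apply: (@continuous_dist_le R 'M[R]_(m, n) _ (fun A B => frob (A - B)))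
  => [A B|A|A B].
- rewrite ler_norml; have := specnorm_lipschitz A B.
  have := specnorm_lipschitz B A; rewrite -opprB frobN.
  by move=> h1 h2; apply/andP; split; lra.
- by rewrite subrr frob0.
have cA : continuous (fun B : 'M[R]_(m, n) => A - B).
  by move=> C; apply: continuousB; [exact: cst_continuous|move=> ?].
exact: (continuous_comp (cA B) (@continuous_frob _ _ _ _)).
Qed.

Lemma stiefel_neq0 (R : realType) (n p : nat) :
  (p <= n)%N -> @stiefel R n p !=set0.
Proof.
move=> pn; exists (pid_mx p).
by rewrite /stiefel /= tr_pid_mx mul_pid_mx (minn_idPr _) ?minnn ?pid_mx_1.
Qed.

Lemma stiefel_max (R : realType) (n p : nat) (h : 'M[R]_(n, p) -> R) :
  (p <= n)%N -> continuous h ->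
  exists2 Y, stiefel Y & forall Z, stiefel Z -> h Z <= h Y.
Proof.
move=> pn ch.
have [Y /set_mem SY hY] := compact_EVT_max (stiefel_neq0 R pn)
  (@compact_stiefel R n p) (continuous_subspaceT ch).
by exists Y => // Z SZ; apply: hY; exact: mem_set.
Qed.

(** * A second-order Taylor inequality *)

Lemma is_derive_line (R : realType) (V W : normedModType R) (f : V -> W)
    (X D : V) (t : R) : differentiable f (X + t *: D) ->
  is_derive t 1 (fun s : R => f (X + s *: D)) ('d f (X + t *: D) D).
Proof.
move=> df.
have dl : is_diff t (cst X + ( *:%R ^~ D : R -> V)) ( *:%R ^~ D : R -> V).
  by apply: is_diff_eq; rewrite add0r.
have dc : is_diff t (f \o (cst X + ( *:%R ^~ D : R -> V)))
    ('d f (X + t *: D) \o ( *:%R ^~ D : R -> V)).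
  by apply: is_diff_comp; apply: DiffDef.
apply: DeriveDef; first by apply/derivable1_diffP; exact: ex_diff.
rewrite deriveE; last exact: ex_diff.
by rewrite diff_val /= scale1r.
Qed.

(** The difference [g - h] has a nonpositive derivative. *)
Lemma le_of_derive_le (R : realType) (g g' h h' : R -> R) (a b : R) :
  (forall t : R, is_derive t 1 g (g' t)) ->
  (forall t : R, is_derive t 1 h (h' t)) ->
  a <= b -> (forall t, a <= t <= b -> g' t <= h' t) ->
  g b - g a <= h b - h a.
Proof.
move=> dg dh ab hle.
have dgh (t : R) : is_derive t 1 (g - h) (g' t - h' t) by exact: is_deriveB.
have cgh : {within `[a, b], continuous (g - h)}.
  apply: continuous_subspaceT => t.
  by apply/differentiable_continuous/derivable1_diffP; case: (dgh t).
have [c] := MVT_segment ab (fun t _ => dgh t) cgh.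
rewrite in_itv /= => /hle hc; rewrite /= => E.
have : (g' c - h' c) * (b - a) <= 0.
  by rewrite mulr_le0_ge0 ?subr_le0 ?subr_ge0.
rewrite -E; rewrite !fctE; lra.
Qed.

Lemma is_derive_quadratic (R : realType) (a b t : R) :
  is_derive t 1 (fun s : R => a * s + b * s ^+ 2) (a + b * (2 * t)).
Proof.
have h1 : is_derive t 1 (a \*: (id : R -> R)) (a *: 1) by exact: is_deriveZ.
have h2 : is_derive t 1 ((id : R -> R) ^+ 2) ((2%:R * t ^+ 1) *: 1).
  exact: (@is_deriveX _ _ id 2).
have h3 : is_derive t 1 (b \*: ((id : R -> R) ^+ 2))
    (b *: ((2%:R * t ^+ 1) *: 1)).
  exact: is_deriveZ.
by have := is_deriveD h1 h3; rewrite !scaler1 expr1.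
Qed.

(** The bound on [psi'] puts [psi] below an affine function, which is the
    derivative of a quadratic one; this puts [phi] below the latter. *)
Lemma taylor2_le (R : realType) (phi psi psi' : R -> R) (c : R) :
  (forall t : R, is_derive t 1 phi (psi t)) ->
  (forall t : R, is_derive t 1 psi (psi' t)) ->
  (forall t, 0 <= t <= 1 -> psi' t <= c) ->
  phi 1 - phi 0 <= psi 0 + c / 2.
Proof.
move=> dphi dpsi hc.
have psi_le t : 0 <= t <= 1 -> psi t <= psi 0 + c / 2 * (2 * t).
  move=> /andP[t0 t1].
  suff : psi t - psi 0 <= (c * t + 0 * t ^+ 2) - (c * 0 + 0 * 0 ^+ 2) by lra.
  apply: (le_of_derive_le dpsi (is_derive_quadratic c 0) t0).
  move=> s /andP[s0 st]; rewrite mul0r addr0.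
  by apply: hc; rewrite s0 (le_trans st).
have := le_of_derive_le dphi (is_derive_quadratic (psi 0) (c / 2)) ler01 psi_le.
lra.
Qed.

(** On the segment from [X] to [X + D] the second derivative of [f] is the inner
    product of [hess f _ D] and [D], which Cauchy-Schwarz bounds by
    [rho * frob D ^+ 2]. *)
Lemma taylor_hess (R : realType) (n p : nat) (f : 'M[R]_(n, p) -> R) (rho : R)
    (X D : 'M[R]_(n, p)) :
  (forall Y, differentiable f Y) -> (forall Y, differentiable (grad f) Y) ->
  (forall t, 0 <= t <= 1 -> opnorm (hess f (X + t *: D)) <= rho) ->
  f (X + D) - f X <= \tr ((grad f X)^T *m D) + rho / 2 * frob D ^+ 2.
Proof.
move=> df dg hrho.
pose phi t := f (X + t *: D).
pose psi t := \tr ((grad f (X + t *: D))^T *m D).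
have dphi (t : R) : is_derive t 1 phi (psi t).
  by rewrite /psi -gradP; exact: is_derive_line.
have dpsi (t : R) : is_derive t 1 psi (\tr ((hess f (X + t *: D) D)^T *m D)).
  pose L : {linear 'M[R]_(n, p) -> R} := @mxtrace R p \o mulmx D^T.
  have cL : continuous L.
    rewrite (_ : (L : _ -> _) = fun B => \sum_i \sum_j D i j * B i j).
      apply: continuous_sumr => i; apply: continuous_sumr => j B.
      exact: (continuous_comp (@coord_continuous _ _ _ i j B)
        (@mulrl_continuous _ (D i j) _)).
    by apply/funext => B; exact: mxtrace_trmul.
  have dL Y : differentiable L Y by exact: linear_differentiable.
  have -> : psi = fun s => (L \o grad f) (X + s *: D).
    by apply/funext => s; exact: mxtrace_trmulC.
  rewrite mxtrace_trmulC -[\tr _]/(L (hess f (X + t *: D) D)).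
  have := @is_derive_line _ _ _ (L \o grad f) X D t.
  rewrite diff_comp // diff_lin //; apply.
  exact: differentiable_comp.
have D0 := frob_ge0 D.
have := taylor2_le (c := rho * frob D ^+ 2) dphi dpsi.
rewrite /phi scale1r scale0r addr0 /psi scale0r addr0 mulrAC; apply=> t t01.
apply: le_trans (mxtrace_le_frob _ _) _.
rewrite expr2 mulrA ler_wpM2r //.
by apply: le_trans (frob_le_opnorm _ _) _; rewrite ler_wpM2r // hrho.
Qed.

(** * Singular value decompositions *)

(** The [i]-th column [v_i] of [V] is a unit vector and [Z v_i = s_i u_i]. *)
Lemma svd_singular_value_le (R : realType) (p : nat) (Z U V : 'M[R]_p)
    (s : 'rV[R]_p) (i : 'I_p) (c : R) : is_svd Z U s V ->
  (forall v : 'cV[R]_p, frob (Z *m v) <= c * frob v) -> s 0 i <= c.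
Proof.
case=> hU hV s0 EZ hc.
have e1 : frob (delta_mx i 0 : 'cV[R]_p) = 1.
  by rewrite /frob trmx_delta mul_delta_mx trace_mx11 mxE !eqxx sqrtr1.
have := hc (V *m delta_mx i 0).
rewrite (frob_mul_stiefel _ hV) e1 mulr1 EZ -!mulmxA (mulmxA V^T) hV mul1mx.
rewrite frob_mul_stiefel // mul_diag_mx.
have -> : (\matrix_(k, j) (s 0 k * delta_mx i 0 k j) : 'cV[R]_p) =
    s 0 i *: delta_mx i 0.
  apply/matrixP => k j; rewrite !mxE.
  by case: eqP => [->|_] //=; rewrite !mulr0.
by rewrite frobZ e1 mulr1 ger0_norm.
Qed.

(** The gap [\tr Z + \sum_i s 0 i] in the von Neumann trace inequality vanishes
    only if [V^T U] is [- I] wherever [s] is nonzero, that is, if [- Z] is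
    positive semidefinite; then [Z] is symmetric, and the bound makes this
    quantitative. *)
Lemma svd_sum_ge (R : realType) (p : nat) (Z U V : 'M[R]_p) (s : 'rV[R]_p)
    (c : R) : is_svd Z U s V -> (forall i, s 0 i <= c) ->
  frob (Z - Z^T) ^+ 2 <= 8 * c * (\tr Z + \sum_i s 0 i).
Proof.
move=> [hU hV s0 EZ] hc.
pose W := V^T *m U.
have hW : stiefel W by apply: stiefel_mul => //; exact: stiefel_trmx.
pose S := diag_mx s.
have trZ : \tr Z = \sum_i s 0 i * W i i.
  rewrite EZ mxtrace_mulC mulmxA mxtrace_mulC; apply: eq_bigr => i _.
  by rewrite mul_diag_mx mxE.
have hVV : V *m V^T = 1%:M.
  by have := stiefel_trmx hV; rewrite /stiefel /= trmxK.
(* Adding [1%:M] to [W] changes nothing since [S] is symmetric, but the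
   [j]-th column of [W + 1%:M] is small exactly when [W j j] is near [- 1]. *)
have Zconj : Z - Z^T = V *m (((W + 1%:M) *m S) - ((W + 1%:M) *m S)^T) *m V^T.
  have VWSV : V *m (W *m S) *m V^T = Z by rewrite /W EZ !mulmxA hVV mul1mx.
  have -> : (W + 1%:M) *m S - ((W + 1%:M) *m S)^T = W *m S - (W *m S)^T.
    by rewrite mulmxDl mul1mx raddfD /= tr_diag_mx opprD addrACA subrr addr0.
  rewrite mulmxBr mulmxBl VWSV; congr (_ - _).
  by rewrite -VWSV [in LHS]trmx_mul [in LHS]trmx_mul trmxK mulmxA.
have normZ : frob (Z - Z^T) <= 2 * frob ((W + 1%:M) *m S).
  rewrite Zconj -frob_trmx trmx_mul trmxK (frob_mul_stiefel _ hV) frob_trmx.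
  rewrite (frob_mul_stiefel _ hV); apply: le_trans (frobB_le _ _) _.
  by rewrite frob_trmx; lra.
have colW j : \sum_i (W i j + (i == j)%:R) ^+ 2 = 2 + 2 * W j j.
  have /stiefelP /(_ j j) := hW; rewrite eqxx mulr1n => E.
  transitivity (\sum_k (W k j * W k j + (k == j)%:R * (2 * W k j + 1))).
    by apply: eq_bigr => k _; move: (W k j) => x; case: eqP => _ /=; ring.
  rewrite big_split /= E (bigD1 j) //= eqxx mulr1n big1; first by ring.
  by move=> k /negbTE ->; rewrite mul0r.
have normWS : frob ((W + 1%:M) *m S) ^+ 2 = \sum_j s 0 j ^+ 2 * (2 + 2 * W j j).
  rewrite frob_sqr exchange_big; apply: eq_bigr => j _.
  rewrite -colW mulr_sumr; apply: eq_bigr => i _.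
  by rewrite mul_mx_diag !mxE -exprMn mulrC.
have W1 j : 0 <= 2 + 2 * W j j.
  by rewrite -colW; apply: sumr_ge0 => i _; exact: sqr_ge0.
apply: (@le_trans _ _ (4 * frob ((W + 1%:M) *m S) ^+ 2)).
  have := normZ; rewrite -(@ler_sqr _ (frob _)) ?nnegrE ?mulr_ge0 ?frob_ge0 //.
  by rewrite exprMn; lra.
rewrite normWS trZ -big_split /= !mulr_sumr; apply: ler_sum => j _.
have := ler_wpM2r (mulr_ge0 (s0 j) (W1 j)) (hc j).
lra.
Qed.

(** * The proximal correction step *)

(** The polar factor [U V^T] of [Z] attains the maximum of [\tr (Z^T *m O)] over
    orthogonal [O]. *)
Lemma svd_polar_trace (R : realType) (p : nat) (Z U V : 'M[R]_p)
    (s : 'rV[R]_p) :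
  is_svd Z U s V -> \tr (Z^T *m (U *m V^T)) = \sum_i s 0 i.
Proof.
case=> hU hV _ ->; rewrite !trmx_mul trmxK tr_diag_mx -!mulmxA (mulmxA U^T) hU.
by rewrite mul1mx mxtrace_mulC -mulmxA hV mulmx1 mxtrace_diag.
Qed.

(** The ball is convex and contains the manifold: [frob X ^+ 2 = p%:R]. *)
Lemma stiefel_segment (R : realType) (n p : nat) (X X' : 'M[R]_(n, p)) (t : R) :
  stiefel X -> stiefel X' -> 0 <= t <= 1 -> stiefel_nbhd (X + t *: (X' - X)).
Proof.
move=> hX hX' /andP[t0 t1]; rewrite /stiefel_nbhd /=.
have eX : frob X' = frob X by rewrite /frob hX hX'.
have -> : X + t *: (X' - X) = (1 - t) *: X + t *: X'.
  by rewrite scalerBr scalerBl scale1r addrA addrAC.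
have le_frob : frob ((1 - t) *: X + t *: X') <= frob X.
  apply: le_trans (frobD_le _ _) _.
  by rewrite !frobZ eX !ger0_norm ?subr_ge0 // -mulrDl subrK mul1r.
apply: (@le_lt_trans _ _ (frob X ^+ 2)).
  by rewrite ler_sqr ?nnegrE ?frob_ge0.
by rewrite frob_sqr_stiefel // ltrDl.
Qed.

Lemma opnorm_hess_le (R : realType) (n p : nat) (f : 'M[R]_(n, p) -> R)
    (rho : R) (Y : 'M[R]_(n, p)) :
  hess_bound f = rho%:E -> stiefel_nbhd Y -> opnorm (hess f Y) <= rho.
Proof.
move=> hb hY; rewrite -lee_fin -hb.
by apply: ereal_sup_ubound; exists Y.
Qed.

(** Along the manifold the quadratic term of the Taylor bound is affine in the
    new point, so the bound becomes, up to a constant, the linear form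
    [\tr (Z^T *m Q)], which the step minimizes. *)
Lemma prox_step_decrease (R : realType) (n p : nat) (f : 'M[R]_(n, p) -> R)
    (rho gamma : R) (X : 'M[R]_(n, p)) (U V : 'M[R]_p) (s : 'rV[R]_p) :
  smooth f rho -> rho <= gamma -> stiefel X ->
  stiefel (X *m - (U *m V^T)) ->
  is_svd (X^T *m grad f X - gamma%:M) U s V ->
  \tr (X^T *m grad f X - gamma%:M) + \sum_i s 0 i <=
    f X - f (X *m - (U *m V^T)).
Proof.
move=> [df _ dg hb] hrho hX; set X' := X *m _ => hX' hZ.
have taylor : f (X + (X' - X)) - f X <=
    \tr ((grad f X)^T *m (X' - X)) + gamma / 2 * frob (X' - X) ^+ 2.
  apply: taylor_hess => // t t01; apply: le_trans hrho.
  by apply: opnorm_hess_le hb _; exact: stiefel_segment.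
have distE : frob (X' - X) ^+ 2 = 2 * p%:R - 2 * \tr (X^T *m X').
  rewrite addrC frob_sqrD frobN !frob_sqr_stiefel // [(- X)^T]raddfN /= mulNmx.
  by rewrite raddfN /=; ring.
have polarE : \tr ((X^T *m grad f X - gamma%:M)^T *m - (U *m V^T)) =
    \tr ((grad f X)^T *m X') - gamma * \tr (X^T *m X').
  rewrite [(_ - _)^T]raddfB /= tr_scalar_mx trmx_mul trmxK mulmxBl.
  rewrite raddfB /= -mulmxA mul_scalar_mx mxtraceZ.
  by rewrite /X' (mulmxA X^T) hX mul1mx.
have trZ : \tr (X^T *m grad f X - gamma%:M) =
    \tr ((grad f X)^T *m X) - gamma * p%:R.
  by rewrite raddfB /= mxtrace_trmulC mxtrace_scalar mulr_natr.
move: polarE; rewrite mulmxN raddfN /= (svd_polar_trace hZ) => polarE.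
move: taylor; rewrite [X + _]addrC subrK mulmxBr raddfB /= distE trZ => taylor.
lra.
Qed.

(** Bessel's inequality replaces [X^T *m G] by [G], whose spectral norm enters
    the constant [M]. *)
Lemma frob_prox_matrix_le (R : realType) (n p : nat) (X G : 'M[R]_(n, p))
    (gamma : R) (v : 'cV[R]_p) : stiefel X -> 0 <= gamma ->
  frob ((X^T *m G - gamma%:M) *m v) <= (specnorm G + gamma) * frob v.
Proof.
move=> hX g0; rewrite mulmxBl mul_scalar_mx mulrDl.
apply: le_trans (frobB_le _ _) _; apply: lerD.
  rewrite -mulmxA; apply: le_trans (frob_tr_stiefel_le _ hX) _.
  exact: frob_le_specnorm.
by rewrite frobZ ger0_norm.
Qed.

Lemma grad_specnorm_max (R : realType) (n p : nat) (f : 'M[R]_(n, p) -> R) :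
  (p <= n)%N -> continuous (grad f) ->
  exists M, is_max [set specnorm (grad f Y) | Y in @stiefel R n p] M.
Proof.
move=> pn cG.
have [Y hY maxY] := stiefel_max pn (fun A =>
  continuous_comp (cG A) (@continuous_specnorm R n p (grad f A))).
exists (specnorm (grad f Y)); split; first by exists Y.
by move=> _ [A hA <-]; exact: maxY.
Qed.

Unset Implicit Arguments.

Theorem lemma3p1 (R : realType) (n p : nat) (hp : (1 <= p)%N) (hpn : (p <= n)%N)
    (f : 'M[R]_(n, p) -> R) (rho gamma : R)
    (hf : smooth f rho) (hrho : rho < gamma) (hgamma : 0 < gamma)
    (X X' : 'M[R]_(n, p)) (hX : stiefel X) (hX' : prox_step f gamma X X') :
  stiefel X' /\
  exists M : R,
    [/\ is_max [set specnorm (grad f Y) | Y in @stiefel R n p] M,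
        0 < M + gamma
      & f X - f X' >=
        1 / (8 * (M + gamma)) *
          frob (X^T *m grad f X - (grad f X)^T *m X) ^+ 2].
Proof.
have [_ cG _ _] := hf.
have [M Mmax] := grad_specnorm_max hpn cG.
have hM : specnorm (grad f X) <= M by apply: (proj2 Mmax); exists X.
have Mg : 0 < M + gamma.
  by apply: ltr_wpDl hgamma; exact: le_trans (specnorm_ge0 _) hM.
set Z := X^T *m grad f X - gamma%:M.
have skewE : X^T *m grad f X - (grad f X)^T *m X = Z - Z^T.
  rewrite /Z [(_ - gamma%:M)^T]raddfB /= trmx_mul trmxK tr_scalar_mx.
  by rewrite opprB addrA subrK.
rewrite skewE; case: hX'; rewrite -/Z => hZ0 hZ.
have [Z0|/eqP Z0] := eqVneq Z 0.
  rewrite (hZ0 Z0) Z0 trmx0 subrr frob0 expr0n /=.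
  by split=> //; exists M; split=> //; rewrite mulr0 subrr.
have [U [s [V [hsvd ->]]]] := hZ Z0.
have [hU hV s0 _] := hsvd.
have hQ : stiefel (- (U *m V^T)).
  have := stiefel_mul hU (stiefel_trmx hV).
  by rewrite /stiefel /= [(- _)^T]raddfN /= mulNmx mulmxN opprK.
have hX' := stiefel_mul hX hQ.
split=> //; exists M; split=> //.
have s_le i : s 0 i <= M + gamma.
  apply: svd_singular_value_le hsvd _ => v.
  apply: le_trans (frob_prox_matrix_le _ _ hX (ltW hgamma)) _.
  by apply: ler_wpM2r; [exact: frob_ge0|rewrite lerD2r].
apply: le_trans (prox_step_decrease hf (ltW hrho) hX hX' hsvd).
rewrite mul1r ler_pdivrMl ?mulr_gt0 //.
exact: svd_sum_ge hsvd s_le.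
Qed.
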